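(* Let $k\ge 1$ be an integer and let $L_{\mathcal C,k}=\{ww\mid w\in\{0,1\}^*,\ |w|_0\not\equiv|w|_1 \pmod k\}$. Then $\mathcal G_{L_{\mathcal C,k}}$ is exactly the class of $k$-colorable graphs.
   Context: $|w|_a$ is the number of occurrences of the letter $a$ in $w$. A graph is $k$-colorable if its vertex set can be partitioned into $k$ (possibly empty) independent sets. Graphs are finite, undirected and simple: $G=(V,E)$ with $V$ a finite non-empty set and $E\subseteq\binom{V}{2}$. A language $L\subseteq\{0,1\}^*$ is $0$-$1$-symmetric if it is invariant under the morphism exchanging $0$ and $1$ (the language here is). For distinct letters $u,v$ of an alphabet $V$, $h_{u,v}:V^*\to\{0,1\}^*$ is the monoid morphism with $u\mapsto 0$, $v\mapsto 1$, and $x\mapsto\lambda$ (empty word) for all other letters $x$. For a $0$-$1$-symmetric $L$ and a word $w\in V^*$ in which every letter of $V$ occurs, $G(L,w)$ is the graph with vertex set $V$ in which distinct $u,v$ are adjacent if and only if $h_{u,v}(w)\in L$. $\mathcal G_L$ is the class of all graphs $G=(V,E)$ with $G=G(L,w)$ for some $w\in V^*$ in which every letter of $V$ occurs. *)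

(* Defs.v *)
From mathcomp Require Import all_boot.

Set Implicit Arguments.
Unset Strict Implicit.
Unset Printing Implicit Defensive.

Record sgraph := SGraph {
  vertex :> finType;
  adj : rel vertex;
  adj_sym : symmetric adj;
  adj_irrefl : irreflexive adj;
  vertex_neq0 : 0 < #|vertex| }.

Arguments adj {s} : rename.

Definition independent (G : sgraph) (A : {set G}) : Prop :=
  forall u v, u \in A -> v \in A -> ~~ adj u v.

(* The classes are given as a family rather than as a set of sets, since some
   of them may be empty. *)
Definition k_colorable (k : nat) (G : sgraph) : Prop :=
  exists A : 'I_k -> {set G},
    [/\ forall i, independent (A i),
        \bigcup_i A i = [set: G] &
        forall i j, i != j -> [disjoint A i & A j]].

(* Binary words are boolean sequences: the letter 0 is [false], 1 is [true]. *)
Definition language := seq bool -> Prop.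

Definition zero_one_symmetric (L : language) : Prop :=
  forall x, L (map negb x) <-> L x.

Record symlang := SymLang {
  lang :> seq bool -> Prop;
  langP : zero_one_symmetric lang }.

(* The morphism h_{u,v}; it is only meaningful for u != v. *)
Definition hproj (V : eqType) (u v : V) (w : seq V) : seq bool :=
  flatten [seq (if x == u then [:: false]
                else if x == v then [:: true] else [::]) | x <- w].

(* The adjacency relation of G(L, w). *)
Definition word_adj (L : symlang) (V : eqType) (w : seq V) (u v : V) : Prop :=
  u != v /\ L (hproj u v w).

Definition graph_class (L : symlang) (G : sgraph) : Prop :=
  exists w : seq G,
    (forall v : G, v \in w) /\
    (forall u v : G, adj u v <-> word_adj L w u v).

Definition LC_lang (k : nat) : language := fun x =>
  exists w : seq bool,
    x = w ++ w /\ count_mem false w <> count_mem true w %[mod k].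

Lemma LC_sym k : zero_one_symmetric (LC_lang k).
Proof.
have cN b w : count_mem b (map negb w) = count_mem (~~ b) w.
  by rewrite count_map; apply: eq_count => c /=; case: b; case: c.
have imp x : LC_lang k x -> LC_lang k (map negb x).
  case=> w [-> neq]; exists (map negb w); split; first by rewrite map_cat.
  by rewrite !cN /= => eq; apply: neq.
by move=> x; split=> [/imp|/imp //]; rewrite (mapK negbK).
Qed.

Definition LC (k : nat) : symlang := SymLang (@LC_sym k).

(* Main.v *)
Require Import Defs.
From mathcomp Require Import all_boot.

(** If [h_{u,v}(w) = xx], then [u] and [v] occur [2|x|_0] and [2|x|_1] times in
    [w], so half the number of occurrences modulo [k] is a proper colouring.
    Conversely, given a colouring [c], let [x] be the concatenation of the words
    [ab] over all pairs of distinct non-adjacent vertices [a], [b], and [y] the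
    concatenation, in the same order, of the words [ba].  The projections of [x]
    and [y] to [{u, v}] have the same length, and they differ exactly when [u]
    and [v] are non-adjacent.  Appending to both a word [t] such that each [v]
    occurs [c v] times modulo [k] in [xt], the word [xtyt] represents the
    graph. *)

Section Projection.

Variable V : eqType.
Implicit Types (u v : V) (w : seq V) (s : seq (V * V)).

Lemma hproj_cat u v w1 w2 : hproj u v (w1 ++ w2) = hproj u v w1 ++ hproj u v w2.
Proof. by rewrite /hproj map_cat flatten_cat. Qed.

(** Serves to show that projections of rearranged words have equal length, so that [eqseq_cat] can
    compare concatenations factor by factor. *)
Lemma perm_hproj u v w1 w2 :
  perm_eq w1 w2 -> perm_eq (hproj u v w1) (hproj u v w2).
Proof. by move=> eq_w; apply/perm_flatten/perm_map. Qed.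

Lemma count_false_hproj u v w : count_mem false (hproj u v w) = count_mem u w.
Proof.
elim: w => //= x w IHw.
by rewrite count_cat -/(hproj u v w) IHw; case: (x == u) => //; case: (x == v).
Qed.

Lemma count_true_hproj u v w :
  u != v -> count_mem true (hproj u v w) = count_mem v w.
Proof.
move=> neq_uv; elim: w => //= x w IHw.
rewrite count_cat -/(hproj u v w) IHw.
by case: (x =P u) => [->|_]; [rewrite (negPf neq_uv) | case: (x == v)].
Qed.

Definition pair_word s : seq V := flatten [seq [:: e.1; e.2] | e <- s].
Definition swap_word s : seq V := flatten [seq [:: e.2; e.1] | e <- s].

Lemma perm_swap2 (a b : V) : perm_eq [:: a; b] [:: b; a].
Proof. by rewrite -[[:: a; b]](cat1s a) perm_catC. Qed.

Lemma perm_swap_word s : perm_eq (pair_word s) (swap_word s).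
Proof.
elim: s => //= e s IHs; rewrite /pair_word /swap_word /=.
by apply: (@perm_cat _ [:: _; _] [:: _; _]) => //; apply: perm_swap2.
Qed.

(** If [a] or [b] lies outside [{u, v}], at most one letter survives and its position is lost;
    otherwise the projections are [01] and [10]. *)
Lemma hproj_swap2 u v a b : u != v -> a != b ->
  (hproj u v [:: a; b] == hproj u v [:: b; a])
    = ((a, b) != (u, v)) && ((a, b) != (v, u)).
Proof.
move=> neq_uv neq_ab; rewrite /hproj /= !xpair_eqE.
case: (a =P u) neq_ab => [-> | _].
  by rewrite (negPf neq_uv) [u == b]eq_sym => /negPf->; case: (b == v).
case: (a =P v) => [-> | _] /=; last by case: (b == u); case: (b == v).
by rewrite [v == b]eq_sym => /negPf->; case: (b == u).
Qed.

(** Matching two-letter blocks project to words of equal length, so the whole projections agree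
    exactly when every block does. *)
Lemma hproj_pair_swap u v s : u != v -> all (fun e => e.1 != e.2) s ->
  (hproj u v (pair_word s) == hproj u v (swap_word s))
    = ((u, v) \notin s) && ((v, u) \notin s).
Proof.
move=> neq_uv; elim: s => //= -[a b] s IHs /andP[/= neq_ab /IHs{}IHs].
rewrite /pair_word /swap_word /= -/(pair_word s) -/(swap_word s).
rewrite -[a :: b :: pair_word s]/([:: a; b] ++ _).
rewrite -[b :: a :: swap_word s]/([:: b; a] ++ _).
rewrite !hproj_cat eqseq_cat; last first.
  exact/perm_size/perm_hproj/perm_swap2.
rewrite hproj_swap2 // IHs !inE !negb_or ![(a, b) == _]eq_sym.
by rewrite -!andbA; do !bool_congr.
Qed.

End Projection.

Arguments pair_word {V} s.
Arguments swap_word {V} s.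

(** Equal lengths force any factorization as a square to cut between [a] and [b]. *)
Lemma LC_lang_cat k a b : size a = size b ->
  LC_lang k (a ++ b) <->
  a = b /\ count_mem false a <> count_mem true a %[mod k].
Proof.
move=> eq_size; split=> [[x [eq_x neq]] | [<- neq]]; last by exists a.
have size_x : size a = size x.
  move/(congr1 size): eq_x; rewrite !size_cat -eq_size !addnn.
  exact: double_inj.
by move/eqP: eq_x; rewrite eqseq_cat // => /andP[/eqP-> /eqP->].
Qed.

Lemma LC_half_count k (V : eqType) (w : seq V) (u v : V) :
  word_adj (LC k) w u v ->
  (count_mem u w)./2 <> (count_mem v w)./2 %[mod k].
Proof.
case=> neq_uv [x [eq_x]].
by rewrite -(count_false_hproj _ u v) -(count_true_hproj _ _ _ w neq_uv) eq_x
  !count_cat !addnn !doubleK.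
Qed.

Lemma graph_class_k_colorable k (G : sgraph) :
  1 <= k -> graph_class (LC k) G -> k_colorable k G.
Proof.
move=> k_gt0 [w [_ adjP]].
exists (fun i : 'I_k => [set v | (count_mem v w)./2 %% k == i]); split.
- move=> i u v; rewrite !inE => /eqP cu /eqP cv; apply/negP => /adjP.
  by move/LC_half_count; apply; rewrite cu cv.
- apply/setP => v; rewrite inE; apply/bigcupP.
  by exists (Ordinal (ltn_pmod (count_mem v w)./2 k_gt0)); rewrite ?inE.
move=> i j neq_ij; rewrite -setI_eq0; apply/eqP/setP => v; rewrite !inE.
by apply/negP => /andP[/eqP-> /eqP/val_inj eq_ij]; rewrite eq_ij eqxx in neq_ij.
Qed.

Lemma count_flatten_nseq (T : finType) (t : T -> nat) v :
  count_mem v (flatten [seq nseq (t x) x | x <- enum T]) = t v.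
Proof.
rewrite count_flatten -map_comp sumnE big_map big_enum /=.
rewrite (bigD1 v) //= count_nseq /= eqxx mul1n big1 ?addn0 // => x neq_xv.
by rewrite count_nseq /= (negPf neq_xv).
Qed.

Lemma coloring_graph_class k (G : sgraph) (c : G -> 'I_k) :
  (forall u v, adj u v -> c u != c v) -> graph_class (LC k) G.
Proof.
move=> proper_c.
pose s := [seq e <- enum {: G * G} | (e.1 != e.2) && ~~ adj e.1 e.2].
pose x := pair_word s; pose y := swap_word s.
(* The intended number of occurrences of [v] in [x ++ t]: congruent to [c v] modulo [k], and larger
   than the count in [x], so that the subtraction in [t] is not truncated and every vertex
   occurs. *)
pose d v := c v + k * (count_mem v x).+1.
pose t := flatten [seq nseq (d v - count_mem v x) v | v <- enum G].
have lt_d v : count_mem v x < d v.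
  have k_gt0 : 0 < k by apply: leq_ltn_trans (ltn_ord (c v)).
  by rewrite ltn_addl // leq_pmull.
have count_xt v : count_mem v (x ++ t) = d v.
  by rewrite count_cat count_flatten_nseq subnKC // ltnW.
have s_neq : all (fun e => e.1 != e.2) s.
  by apply/allP => e; rewrite mem_filter => /andP[/andP[]].
have mem_s u v : u != v -> ((u, v) \in s) = ~~ adj u v.
  by move=> neq_uv; rewrite mem_filter mem_enum neq_uv andbT.
have perm_xy : perm_eq (x ++ t) (y ++ t) by rewrite perm_cat2r perm_swap_word.
have xtP u v : u != v -> (hproj u v (x ++ t) == hproj u v (y ++ t)) = adj u v.
  (* The common suffix [t] cancels, leaving the comparison of [x] with [y]. *)
  move=> neq_uv; rewrite !hproj_cat eqseq_cat; last first.
    exact/perm_size/perm_hproj/perm_swap_word.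
  have neq_vu : v != u by rewrite eq_sym.
  rewrite eqxx andbT hproj_pair_swap // (mem_s _ _ neq_uv) (mem_s _ _ neq_vu).
  by rewrite !negbK [adj v u]adj_sym andbb.
exists ((x ++ t) ++ (y ++ t)); split=> [v | u v].
  rewrite mem_cat; apply/orP; left.
  by rewrite -has_pred1 has_count count_xt (leq_trans _ (lt_d v)).
have LCP : lang (LC k) (hproj u v ((x ++ t) ++ (y ++ t))) <->
    hproj u v (x ++ t) = hproj u v (y ++ t) /\
    count_mem false (hproj u v (x ++ t))
      <> count_mem true (hproj u v (x ++ t)) %[mod k].
  by rewrite hproj_cat; apply: LC_lang_cat; apply/perm_size/perm_hproj.
split=> [adj_uv | [neq_uv /LCP[/eqP]]]; last by rewrite xtP.
have neq_uv : u != v by apply: contraTneq adj_uv => ->; rewrite adj_irrefl.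
split=> //; apply/LCP; split; first by apply/eqP; rewrite xtP.
rewrite count_false_hproj count_true_hproj // !count_xt /d.
(* Modulo [k], the counts [d u] and [d v] reduce to the colours themselves, which are below [k]. *)
rewrite ![_ + k * _]addnC ![k * _]mulnC !modnMDl !modn_small // => eq_c.
by have /negP := proper_c _ _ adj_uv; apply; apply/eqP/val_inj.
Qed.

Lemma k_colorable_coloring k (G : sgraph) : k_colorable k G ->
  exists c : G -> 'I_k, forall u v, adj u v -> c u != c v.
Proof.
case=> A [indep_A cover_A _].
have color v : exists i, v \in A i.
  have : v \in \bigcup_i A i by rewrite cover_A inE.
  by case/bigcupP => i _; exists i.
exists (fun v => xchoose (color v)) => u v adj_uv.
apply/eqP => eq_c; have Au := xchooseP (color u).
rewrite eq_c in Au.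
by have := indep_A _ _ _ Au (xchooseP (color v)); rewrite adj_uv.
Qed.

Theorem theorem20 (k : nat) (hk : 1 <= k) (G : sgraph) :
  graph_class (LC k) G <-> k_colorable k G.
Proof.
split; first exact: graph_class_k_colorable.
by case/k_colorable_coloring => c /coloring_graph_class.
Qed.
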